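(* Let $A$ be a poset with order $\le$, let $(\cdot,\to)$ be an adjunction on $A$, and let $1\in A$. Then the following are equivalent: (a) $(A,\to,1)$ is a wBCK*-algebra; (b) $(A,\cdot,1)$ is a commutative groupoid in which $1$ is a neutral element and $1$ is also the greatest element of $A$. Moreover, if these conditions hold, then the wBCK*-algebra $(A,\to,1)$ is weakly contractive if and only if the groupoid $(A,\cdot)$ is idempotent (i.e. $x\cdot x=x$ for all $x$).
   Context: An adjunction on a poset $A$ is a pair $(\cdot,\to)$ of binary operations on $A$ such that for all $x,y,z$: $x\le y\to z$ if and only if $x\cdot y\le z$. A wBCK*-algebra is an algebra $(A,\to,1)$ where $A$ is a poset with greatest element $1$, $x\le y$ iff $x\to y=1$, and for all $x,y,z$: if $x\le y\to z$ then $y\le x\to z$. It is weakly contractive if moreover for all $x,y$: if $x\le x\to y$ then $x\le y$. *)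

(* Defs.v *)
From Stdlib Require Import ssreflect ssrfun Relation_Definitions.

(* x * y is [mul x y] and x -> y is [imp x y]; a poset is a type A with a
   relation [le] satisfying [order A le] (reflexive, transitive, antisymmetric,
   not assumed decidable). *)

Definition is_greatest {A : Type} (le : A -> A -> Prop) (one : A) : Prop :=
  forall x, le x one.

Definition adjunction {A : Type} (le : A -> A -> Prop)
    (mul imp : A -> A -> A) : Prop :=
  forall x y z, le x (imp y z) <-> le (mul x y) z.

(* The order of the algebra is kept explicit, so that [is_wBCKs le imp one]
   says that its underlying poset is (A, le). *)
Record is_wBCKs {A : Type} (le : A -> A -> Prop)
    (imp : A -> A -> A) (one : A) : Prop := {
  wBCKs_order : order A le;
  wBCKs_greatest : is_greatest le one;
  wBCKs_imp1 : forall x y, le x y <-> imp x y = one;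
  wBCKs_exchange : forall x y z, le x (imp y z) -> le y (imp x z)
}.

Definition weakly_contractive {A : Type} (le : A -> A -> Prop)
    (imp : A -> A -> A) : Prop :=
  forall x y, le x (imp x y) -> le x y.

(* No associativity: the groupoid (A, mul) is just a magma. *)
Record is_comm_unital_groupoid {A : Type}
    (mul : A -> A -> A) (one : A) : Prop := {
  groupoid_mulC : commutative mul;
  groupoid_mul1x : left_id one mul;
  groupoid_mulx1 : right_id one mul
}.

(* Main.v *)
Require Import Defs.
From Stdlib Require Import ssreflect ssrfun Relation_Definitions.
From Stdlib Require Import Setoid.

(** By adjunction the upper bounds of [mul x y] are the [z] with
    [le x (imp y z)], and an element of a poset is determined by its upper
    bounds. Hence exchange amounts to commutativity of [mul],
    [le x y <-> imp x y = one] to neutrality of the greatest element, and weak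
    contractivity to [le x (mul x x)]. *)

Lemma eq_upper_bounds {A : Type} {le : A -> A -> Prop} {x y : A} :
  order A le -> (forall z, le x z <-> le y z) -> x = y.
Proof.
move=> [refl _ anti] xy; apply: anti.
- by apply/xy; apply: refl.
- by apply/xy; apply: refl.
Qed.

(** Turns an equation [imp x y = one] into [le one (imp x y)], a form to which the adjunction
    applies. *)
Lemma greatest_le_eq {A : Type} {le : A -> A -> Prop} {one x : A} :
  order A le -> is_greatest le one -> le one x <-> x = one.
Proof.
move=> [refl _ anti] top; split=> [le1x | ->]; last exact: refl.
by apply: anti.
Qed.

Lemma wBCKs_groupoid {A : Type} {le : A -> A -> Prop}
    {mul imp : A -> A -> A} {one : A} :
  adjunction le mul imp -> is_wBCKs le imp one ->
  is_comm_unital_groupoid mul one.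
Proof.
move=> adj [ord top imp1 exch].
have mulC : commutative mul.
  move=> x y; apply: (eq_upper_bounds ord) => z.
  by rewrite -!adj; split; apply: exch.
have mul1x : left_id one mul.
  move=> x; apply: (eq_upper_bounds ord) => z.
  (* Both sides become [imp x z = one]. *)
  by rewrite -adj (greatest_le_eq ord top) imp1.
by split=> // x; rewrite mulC mul1x.
Qed.

Lemma groupoid_wBCKs {A : Type} {le : A -> A -> Prop}
    {mul imp : A -> A -> A} {one : A} :
  order A le -> adjunction le mul imp ->
  is_comm_unital_groupoid mul one -> is_greatest le one ->
  is_wBCKs le imp one.
Proof.
move=> ord adj [mulC mul1x _] top; split=> // [x y | x y z].
- by rewrite -(greatest_le_eq ord top) adj mul1x.
- by rewrite !adj mulC.
Qed.

Lemma weakly_contractive_idempotent {A : Type} {le : A -> A -> Prop}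
    {mul imp : A -> A -> A} {one : A} :
  adjunction le mul imp -> is_wBCKs le imp one ->
  weakly_contractive le imp <-> idempotent_op mul.
Proof.
move=> adj [[refl _ anti] top imp1 _]; split=> [wc x | idem x y].
- apply: anti.
  (* [le (mul x x) x] is adjoint to [le x (imp x x)], where [imp x x] is the greatest element. *)
  + have /imp1 xx1 := refl x.
    by apply/adj; rewrite xx1; apply: top.
  (* Contractivity is used with [y := mul x x]: its premise [le x (imp x (mul x x))] is adjoint to
     reflexivity at [mul x x]. *)
  + by apply/wc/adj; apply: refl.
- by rewrite adj idem.
Qed.

Theorem theorem4p3 (A : Type) (le : A -> A -> Prop)
    (mul imp : A -> A -> A) (one : A)
    (le_order : order A le) (adj : adjunction le mul imp) :
  (is_wBCKs le imp one <->
     is_comm_unital_groupoid mul one /\ is_greatest le one)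
  /\ (is_wBCKs le imp one ->
        (weakly_contractive le imp <-> idempotent_op mul)).
Proof.
split; last exact: weakly_contractive_idempotent.
split=> [wB | [grp top]]; last exact: groupoid_wBCKs.
split; first exact: wBCKs_groupoid wB.
exact: wBCKs_greatest wB.
Qed.
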